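(* Let $\ell>0$. Let $r_0\in\mathbb{R}$, $v\in C^2(\mathbb{R})$ and suppose that $v\le\Theta$ in $(-\infty,r_0]$. Let also $T>0$ and $\lambda\in C^1([0,T],(0,+\infty))$. Suppose that either $\lambda$ vanishes identically or it is a non-constant function. Suppose that $u$ is a solution of $$\partial_t u(x,t)=c\,\partial_x^2u(x,t)+\int_{x-\ell}^{x+\ell}\big(u(y,t)-\Theta\big)_+\,dy$$ for all $x\in\mathbb{R}$ and $t\in(0,T)$, having the form $$u(x,t)=v\big(\lambda(t)\,x\big).$$ Then $u(x,t)\le\Theta$ for all $x\in\mathbb{R}$ and $t\in[0,T]$, and $u$ is a self-similar solution of the heat equation of the following form: there exist $\lambda_0,v_0,v_1,a\in\mathbb{R}$ with $1+2ac\lambda_0^2t>0$ such that $$u(x,t)=\widetilde v\big(\widetilde\lambda(t)\,x\big),\qquad\text{with}\quad\widetilde v(r)=v_0+v_1\int_0^re^{-\frac{a\rho^2}{2}}\,d\rho\quad\text{and}\quad\widetilde\lambda(t)=\frac{\lambda_0}{\sqrt{1+2ac\lambda_0^2t}},$$ for all $x\in\mathbb{R}$ and $t\in[0,T]$.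
   Context: Here $c\in(0,+\infty)$, $\Theta\in\mathbb{R}$, and $r_+:=\max\{r,0\}$ for $r\in\mathbb{R}$. *)

(* Defs.v *)
(* Stdlib real numbers with Coquelicot. *)
From Stdlib Require Import Reals Lra.
From Coquelicot Require Import Coquelicot.

Open Scope R_scope.

Definition pos_part (r : R) : R := Rmax r 0.

Definition Icc (a b : R) : R -> Prop := fun t => a <= t <= b.

Definition C2 (f : R -> R) : Prop :=
  (forall (k : nat) (x : R), (k <= 2)%nat -> ex_derive_n f k x) /\
  (forall x : R, continuous (Derive_n f 2) x).

(* Derivative and continuity are relative to [a, b] (one-sided at the
   endpoints), so that only the values of f on [a, b] matter. *)
Definition C1_on (f : R -> R) (a b : R) : Prop :=
  exists df : R -> R, forall t : R, Icc a b t ->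
    D_in f df (Icc a b) t /\ continue_in df (Icc a b) t.

(* Coquelicot's [Derive] and [RInt] are total: existence of the derivatives
   and of the integral has to be required separately. *)
Definition has_heat_derivatives (u : R -> R -> R) (x t : R) : Prop :=
  ex_derive (fun s => u x s) t /\
  (forall k : nat, (k <= 2)%nat -> ex_derive_n (fun y => u y t) k x).

Definition solves_nonlocal (c Theta l T : R) (u : R -> R -> R) : Prop :=
  forall x t : R, 0 < t < T ->
    has_heat_derivatives u x t /\
    ex_RInt (fun y => pos_part (u y t - Theta)) (x - l) (x + l) /\
    Derive (fun s => u x s) t =
      c * Derive_n (fun y => u y t) 2 x
      + RInt (fun y => pos_part (u y t - Theta)) (x - l) (x + l).

Definition solves_heat (c T : R) (u : R -> R -> R) : Prop :=
  forall x t : R, 0 < t < T ->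
    has_heat_derivatives u x t /\
    Derive (fun s => u x s) t = c * Derive_n (fun y => u y t) 2 x.

Definition heat_profile (v0 v1 a r : R) : R :=
  v0 + v1 * RInt (fun rho => exp (- (a * rho ^ 2 / 2))) 0 r.

Definition heat_scaling (c lambda0 a t : R) : R :=
  lambda0 / sqrt (1 + 2 * a * c * lambda0 ^ 2 * t).

(* Main.v *)
Require Import Defs.
From Stdlib Require Import Reals Lra Lia Classical.
From Coquelicot Require Import Coquelicot.

Open Scope R_scope.

(** Put [r = lambda(t) x].  At each time, the equation for [u] becomes an
    equation for the profile on the whole line, with [L = lambda(t)] and
    [A = lambda'(t) / lambda(t)^3]:
    [A r v'(r) = c v''(r) + W_L(r) / L^2],
    where [W_L(r)] integrates the excess of [v] over [Theta] over a window
    which, in the variable of [v], is [(r - L l, r + L l)]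
    ([profile_equation_of_solution]).

    A positive non-constant [lambda] takes two values [L1 < L2] at interior
    times, and comparing the two profile equations forces [v <= Theta].
    Suppose that [v <= Theta] to the left of [B].  Where the shorter window
    stays to the left of [B], that is for [r < B - L1 l], the profile solves
    the linear equation [A1 r v' = c v''], whose solutions have [v'] either
    identically zero or nowhere zero.  If [v'] vanishes, then so does [v''];
    if not, evaluating both equations far to the left, where neither window
    sees any excess, gives [A1 = A2].  In both cases the equation for [L2]
    yields [W_L2(r) = 0] for all [r < B - L1 l], although the window of [L2]
    reaches beyond [B]; hence [v <= Theta] up to [B + l (L2 - L1)]
    ([threshold_bound_step]).  The gain does not depend on [B], so iterating
    covers the line ([threshold_bound]).

    The integral term is then zero, and [c v'' = A r v'] everywhere and at all
    times.  Unless [v] is constant, [A] equals a constant [k], so that [v'] is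
    a Gaussian ([profile_of_gaussian_ode]), while [lambda' = k lambda^3] means
    that [1 / lambda^2] is affine with slope [- 2 k]
    ([scaling_of_cubic_ode]). *)

(** * Differentiation on an interval *)

Lemma continuous_derive0_const (f : R -> R) (a b : R) :
  (forall x, a <= x <= b -> continuity_pt f x) ->
  (forall x, a < x < b -> is_derive f x 0) ->
  forall x, a <= x <= b -> f x = f a.
Proof.
  intros Hc Hd x Hx.
  assert (Hd' : forall y, a < y < b -> derivable_pt_lim f y 0)
    by (intros y Hy; apply is_derive_Reals, Hd, Hy).
  set (pr := fun y (Hy : a < y < b) =>
               exist (fun d => derivable_pt_abs f y d) 0 (Hd' y Hy)).
  exact (null_derivative_loc f a b pr Hc (fun _ _ => eq_refl) x Hx).
Qed.

(** Composing with the projection of the line onto [[a, b]] extends the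
    function continuously.  This turns the one-sided notions at the endpoints
    into the two-sided ones that the mean value theorem asks for, without
    changing interior derivatives. *)
Lemma C1_on_extension (f : R -> R) (a b : R) :
  a < b -> C1_on f a b ->
  exists g dg : R -> R,
    (forall t, a <= t <= b -> g t = f t) /\
    (forall t, continuity_pt g t) /\
    (forall t, a < t < b -> is_derive g t (dg t)).
Proof.
  intros Hab [df Hf].
  set (p := fun t => Rmax a (Rmin t b)).
  assert (Hp : forall t, a <= p t <= b).
  { intros t; unfold p, Rmax, Rmin.
    destruct (Rle_dec t b); destruct (Rle_dec a _); lra. }
  assert (Hid : forall t, a <= t <= b -> p t = t).
  { intros t Ht; unfold p, Rmax, Rmin.
    destruct (Rle_dec t b); destruct (Rle_dec a _); lra. }
  assert (Hlip : forall t s, Rabs (p t - p s) <= Rabs (t - s)).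
  { intros t s; unfold p, Rmax, Rmin.
    destruct (Rle_dec t b); destruct (Rle_dec a _);
      destruct (Rle_dec s b); destruct (Rle_dec a _);
      unfold Rabs; repeat destruct Rcase_abs; lra. }
  exists (fun t => f (p t)), df; split; [|split].
  - intros t Ht; now rewrite Hid.
  - intros t eps Heps.
    assert (Hcont : continue_in f (Icc a b) (p t))
      by (apply (cont_deriv f df), Hf, Hp).
    destruct (Hcont eps Heps) as [alp [Halp Hx]].
    exists alp; split; [exact Halp|].
    intros s [_ Hs]; simpl in Hs; unfold Rdist in Hs.
    destruct (Req_dec (p t) (p s)) as [E|E].
    + rewrite E; simpl; unfold Rdist; rewrite Rminus_diag, Rabs_R0; lra.
    + apply Hx; split.
      * split; [apply Hp | exact E].
      * simpl; unfold Rdist; specialize (Hlip s t); lra.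
  - intros t Ht.
    apply is_derive_Reals; intros eps Heps.
    destruct (Hf t ltac:(unfold Icc; lra)) as [HD _].
    destruct (HD eps Heps) as [alp [Halp Hx]].
    (* The increment must also be small enough to stay inside [[a, b]]. *)
    assert (Hdel : 0 < Rmin alp (Rmin (t - a) (b - t)))
      by (repeat apply Rmin_pos; lra).
    exists (mkposreal _ Hdel); simpl; intros h Hh0 Hh.
    assert (H1 : Rabs h < alp)
      by (eapply Rlt_le_trans; [exact Hh | apply Rmin_l]).
    assert (H2 : Rabs h < t - a)
      by (eapply Rlt_le_trans; [exact Hh |];
          eapply Rle_trans; [apply Rmin_r | apply Rmin_l]).
    assert (H3 : Rabs h < b - t)
      by (eapply Rlt_le_trans; [exact Hh |];
          eapply Rle_trans; [apply Rmin_r | apply Rmin_r]).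
    apply Rabs_def2 in H2; apply Rabs_def2 in H3.
    rewrite (Hid (t + h)), (Hid t) by lra.
    specialize (Hx (t + h)); simpl in Hx; unfold Rdist in Hx.
    replace (t + h - t) with h in Hx by ring.
    apply Hx; repeat split; unfold Icc; lra.
Qed.

(** * The linear equation of the Gaussian profile *)

(** [exp (- k r^2 / 2)] is an integrating factor of [y' = k r y].  The
    equation is only required on a half-line because it is first known there,
    before [v <= Theta] has been extended to the right. *)
Lemma gaussian_ode_invariant (y : R -> R) (k b : R) :
  (forall r, r < b -> is_derive y r (k * r * y r)) ->
  forall r s, r < b -> s < b ->
    y r * exp (- (k * r ^ 2 / 2)) = y s * exp (- (k * s ^ 2 / 2)).
Proof.
  intros Hy.
  assert (Hd : forall r, r < b ->
            is_derive (fun r => y r * exp (- (k * r ^ 2 / 2))) r 0).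
  { intros r Hr; specialize (Hy r Hr).
    assert (He : ex_derive y r) by (eexists; exact Hy).
    auto_derive; [easy|].
    rewrite (is_derive_unique (fun x : R => y x) r _ Hy); field. }
  assert (Hle : forall r s, r <= s -> s < b ->
    y r * exp (- (k * r ^ 2 / 2)) = y s * exp (- (k * s ^ 2 / 2))).
  { intros r s Hrs Hs; symmetry.
    apply (continuous_derive0_const
             (fun r => y r * exp (- (k * r ^ 2 / 2))) r s); [| |lra].
    - intros x Hx; apply continuity_pt_filterlim.
      apply (ex_derive_continuous (fun r => y r * exp (- (k * r ^ 2 / 2)))).
      eexists; apply Hd; lra.
    - intros x Hx; apply Hd; lra. }
  intros r s Hr Hs; destruct (Rle_dec r s).
  - apply Hle; lra.
  - symmetry; apply Hle; lra.
Qed.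

Lemma gaussian_ode_zero (y : R -> R) (k b r1 : R) :
  (forall r, r < b -> is_derive y r (k * r * y r)) ->
  r1 < b -> y r1 = 0 -> forall r, r < b -> y r = 0.
Proof.
  intros Hy Hr1 H0 r Hr.
  pose proof (gaussian_ode_invariant y k b Hy r r1 Hr Hr1) as H.
  rewrite H0, Rmult_0_l in H.
  apply Rmult_integral in H; destruct H as [H|H]; [exact H|].
  pose proof (exp_pos (- (k * r ^ 2 / 2))); lra.
Qed.

(** * Excess over the threshold in a window *)

(** The primitive of [f] from [a] is squeezed between two values [0] on
    [[a, b]], so it vanishes there and so does its derivative. *)
Lemma RInt_nonneg_eq0 (f : R -> R) (a b : R) :
  (forall x, continuous f x) -> (forall x, 0 <= f x) ->
  RInt f a b = 0 -> forall x, a < x < b -> f x = 0.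
Proof.
  intros Hc Hpos H0 x Hx.
  assert (Hex : forall s t, ex_RInt f s t)
    by (intros s t; apply (ex_RInt_continuous f); intros; apply Hc).
  assert (Hz : forall y, a < y < b -> RInt f a y = 0).
  { intros y Hy.
    pose proof (RInt_Chasles f a y b (Hex _ _) (Hex _ _)) as HC.
    assert (H1 : 0 <= RInt f a y) by (apply RInt_ge_0; [lra|auto|auto]).
    assert (H2 : 0 <= RInt f y b) by (apply RInt_ge_0; [lra|auto|auto]).
    unfold plus in HC; simpl in HC; lra. }
  assert (D1 : is_derive (fun y => RInt f a y) x (f x)).
  { apply (is_derive_RInt f (fun y => RInt f a y) a x); [|apply Hc].
    apply filter_forall; intros y; apply (RInt_correct f), Hex. }
  assert (D2 : is_derive (fun y => RInt f a y) x 0).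
  { apply (is_derive_ext_loc (fun _ => 0)); [|apply @is_derive_const].
    apply (locally_interval _ x (Finite a) (Finite b)); simpl; try lra.
    intros y Hy1 Hy2; symmetry; apply Hz; simpl in *; lra. }
  apply is_derive_unique in D1; apply is_derive_unique in D2; lra.
Qed.

(** The integral term at the point [x = r / L] when the scaling is [L].  The
    integration variable is that of [u], so this is [1 / L] times the integral
    of the excess of [v] over [(r - L l, r + L l)]. *)
Definition window_excess (Theta l : R) (v : R -> R) (L r : R) : R :=
  RInt (fun y => pos_part (v (L * y) - Theta)) (r / L - l) (r / L + l).

Lemma window_excess_eq0 (Theta l : R) (v : R -> R) (L r : R) :
  0 < L -> 0 < l -> (forall s, s < r + L * l -> v s <= Theta) ->
  window_excess Theta l v L r = 0.
Proof.
  intros HL Hl Hv; unfold window_excess.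
  rewrite (RInt_ext _ (fun _ => 0)).
  - rewrite RInt_const; unfold scal; simpl; unfold mult; simpl; ring.
  - intros y Hy; rewrite Rmin_left, Rmax_right in Hy by lra.
    unfold pos_part; apply Rmax_right.
    enough (v (L * y) <= Theta) by lra.
    apply Hv; replace (r + L * l) with (L * (r / L + l)) by (field; lra).
    apply Rmult_lt_compat_l; lra.
Qed.

Lemma window_excess_eq0_inv (Theta l : R) (v : R -> R) (L r : R) :
  0 < L -> (forall x, continuous v x) ->
  window_excess Theta l v L r = 0 ->
  forall s, r - L * l < s < r + L * l -> v s <= Theta.
Proof.
  intros HL Hv H0 s Hs; unfold window_excess in H0.
  assert (Hz : pos_part (v (L * (s / L)) - Theta) = 0).
  { apply (RInt_nonneg_eq0 (fun y => pos_part (v (L * y) - Theta))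
             _ _) with (3 := H0).
    - intros y; unfold pos_part.
      (* The positive part of [z] is [(z + |z|) / 2]. *)
      apply (continuous_ext
        (fun y => (v (L * y) - Theta + Rabs (v (L * y) - Theta)) / 2)).
      { intros z; unfold Rmax, Rabs.
        destruct (Rle_dec _ _); destruct Rcase_abs; lra. }
      assert (Hk : continuous (fun y => v (L * y) - Theta) y).
      { apply (continuous_minus (fun y => v (L * y)) (fun _ => Theta));
          [|apply continuous_const].
        apply (continuous_comp (fun y => L * y) v); [|apply Hv].
        apply (ex_derive_continuous (fun y => L * y)); auto_derive; auto. }
      apply (continuous_mult
        (fun y => v (L * y) - Theta + Rabs (v (L * y) - Theta)) (fun _ => / 2));
        [|apply continuous_const].
      apply (continuous_plus (fun y => v (L * y) - Theta)
        (fun y => Rabs (v (L * y) - Theta))); [exact Hk|].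
      apply (continuous_comp (fun y => v (L * y) - Theta) Rabs); [exact Hk|].
      apply continuous_Rabs.
    - intros y; apply Rmax_r.
    - replace (r / L - l) with ((r - L * l) / L) by (field; lra).
      replace (r / L + l) with ((r + L * l) / L) by (field; lra).
      unfold Rdiv; split; apply Rmult_lt_compat_r;
        try (apply Rinv_0_lt_compat); lra. }
  replace (L * (s / L)) with s in Hz by (field; lra).
  unfold pos_part in Hz; pose proof (Rmax_l (v s - Theta) 0); lra.
Qed.

(** * The profile equation *)

(** Here [A] stands for [lambda' / lambda^3].  Only [L] and [A] depend on time,
    so different times constrain the same [v]. *)
Definition profile_equation (c Theta l : R) (v : R -> R) (L A : R) : Prop :=
  forall r, A * (r * Derive v r) =
            c * Derive_n v 2 r + window_excess Theta l v L r / L ^ 2.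

Lemma profile_equation_of_solution (c Theta l T : R) (v lambda dlam : R -> R)
    (u : R -> R -> R) (t : R) :
  C2 v -> solves_nonlocal c Theta l T u ->
  (forall x t, 0 <= t <= T -> u x t = v (lambda t * x)) ->
  0 < t < T -> 0 < lambda t -> is_derive lambda t (dlam t) ->
  profile_equation c Theta l v (lambda t) (dlam t / lambda t ^ 3).
Proof.
  intros Hv Hu Hform Ht HL Hd r.
  destruct (Hu (r / lambda t) t Ht) as [_ [_ E]].
  assert (Et : Derive (fun s => u (r / lambda t) s) t
               = dlam t * (r / lambda t) * Derive v r).
  { apply is_derive_unique.
    apply (is_derive_ext_loc (fun s => v (lambda s * (r / lambda t)))).
    { apply (locally_interval _ t (Finite 0) (Finite T)); simpl; try lra.
      intros s H1 H2; symmetry; apply Hform; simpl in *; lra. }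
    apply (is_derive_comp v (fun s => lambda s * (r / lambda t))).
    - replace (lambda t * (r / lambda t)) with r by (field; lra).
      apply Derive_correct, (proj1 Hv 1%nat r); lia.
    - assert (He : ex_derive lambda t) by (eexists; exact Hd).
      auto_derive; [easy|].
      rewrite (is_derive_unique (fun x : R => lambda x) t _ Hd); ring. }
  assert (Ex : Derive_n (fun y => u y t) 2 (r / lambda t)
               = lambda t ^ 2 * Derive_n v 2 r).
  { rewrite (Derive_n_ext _ (fun y => v (lambda t * y)))
      by (intros y; apply Hform; lra).
    rewrite Derive_n_comp_scal.
    - now replace (lambda t * (r / lambda t)) with r by (field; lra).
    - apply filter_forall; intros y k Hk; now apply Hv. }
  rewrite Et, Ex in E.
  rewrite (RInt_ext _ (fun y => pos_part (v (lambda t * y) - Theta))) in E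
    by (intros y _; rewrite Hform by lra; reflexivity).
  fold (window_excess Theta l v (lambda t) r) in E.
  apply Rmult_eq_reg_l with (lambda t ^ 2); [|apply pow_nonzero; lra].
  transitivity (dlam t * (r / lambda t) * Derive v r); [field; lra|].
  rewrite E; field; lra.
Qed.

Lemma profile_gaussian_ode (c Theta l : R) (v : R -> R) (L A b : R) :
  0 < c -> 0 < L -> 0 < l -> C2 v ->
  profile_equation c Theta l v L A ->
  (forall r, r < b -> forall s, s < r + L * l -> v s <= Theta) ->
  forall r, r < b -> is_derive (Derive v) r (A / c * r * Derive v r).
Proof.
  intros Hc HL Hl Hv HE Hb r Hr.
  replace (A / c * r * Derive v r) with (Derive_n v 2 r).
  - apply (Derive_correct (Derive v)), (proj1 Hv 2%nat r); lia.
  - specialize (HE r); rewrite window_excess_eq0 in HE by (auto; now apply Hb).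
    replace (A / c * r * Derive v r) with (A * (r * Derive v r) / c)
      by (field; lra).
    rewrite HE; field; split; lra.
Qed.

(** * The profile stays below the threshold *)

(** The bound on the left of [B] makes the equation for [L1] homogeneous
    already on [r < B - l L1], where the wider window of [L2] still sees a
    piece of length up to [l (L2 - L1)] beyond [B].  Both equations have to
    agree there, which leaves no excess for that piece. *)
Lemma threshold_bound_step (c Theta l : R) (v : R -> R) (L1 L2 A1 A2 B : R) :
  0 < c -> 0 < l -> 0 < L1 -> L1 < L2 -> C2 v ->
  profile_equation c Theta l v L1 A1 ->
  profile_equation c Theta l v L2 A2 ->
  (forall s, s < B -> v s <= Theta) ->
  forall s, s < B + l * (L2 - L1) -> v s <= Theta.
Proof.
  intros Hc Hl HL1 HL12 Hv E1 E2 HB.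
  assert (Hcont : forall x, continuous v x).
  { intros x; apply (ex_derive_continuous v), (proj1 Hv 1%nat x); lia. }
  assert (Hlm : l * L1 < l * L2) by (apply Rmult_lt_compat_l; lra).
  assert (Hlm0 : 0 < l * L1) by (apply Rmult_lt_0_compat; lra).
  assert (O1 : forall r, r < B - l * L1 ->
            is_derive (Derive v) r (A1 / c * r * Derive v r)).
  { apply (profile_gaussian_ode c Theta l v L1); auto.
    intros r Hr s Hs; apply HB; lra. }
  assert (N : forall r, r < B - l * L1 -> window_excess Theta l v L2 r = 0).
  { assert (W1 : forall r, r < B - l * L1 ->
              A1 * (r * Derive v r) = c * Derive_n v 2 r).
    { intros r Hr; rewrite (E1 r), window_excess_eq0; auto; [field; lra|].
      intros s Hs; apply HB; lra. }
    assert (Hk : forall r, r < B - l * L1 ->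
              A2 * (r * Derive v r) = A1 * (r * Derive v r) ->
              window_excess Theta l v L2 r = 0).
    { intros r Hr H; rewrite (W1 r Hr), (E2 r) in H.
      assert (window_excess Theta l v L2 r / L2 ^ 2 = 0) as H0 by lra.
      apply Rmult_integral in H0; destruct H0 as [H0|H0]; [exact H0|].
      exfalso; revert H0; apply Rinv_neq_0_compat, pow_nonzero; lra. }
    (* At [r1] neither window sees any excess; [r1 <> 0] allows to divide by
       [r1 * Derive v r1]. *)
    set (r1 := Rmin (B - l * L2) 0 - 1).
    assert (Hr1 : r1 < B - l * L2 /\ r1 < 0).
    { unfold r1; pose proof (Rmin_l (B - l * L2) 0);
        pose proof (Rmin_r (B - l * L2) 0); lra. }
    destruct (Req_dec (Derive v r1) 0) as [Z|Z].
    - intros r Hr; apply Hk; [exact Hr|].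
      rewrite (gaussian_ode_zero (Derive v) (A1 / c) (B - l * L1) r1 O1
                 ltac:(lra) Z r Hr); ring.
    - assert (A1 = A2) as HA.
      { pose proof (W1 r1 ltac:(lra)) as H1; pose proof (E2 r1) as H2.
        rewrite window_excess_eq0 in H2;
          [|lra|lra|intros s Hs; apply HB; lra].
        apply Rmult_eq_reg_r with (r1 * Derive v r1).
        - rewrite H1, H2; field; lra.
        - apply Rmult_integral_contrapositive; split; lra. }
      intros r Hr; apply Hk; [exact Hr|]; now rewrite HA. }
  intros s Hs; destruct (Rlt_dec s B) as [HsB|HsB]; [now apply HB|].
  (* For [B <= s < B + l * (L2 - L1)], some window of [L2] centred to the
     left of [B - l * L1] contains [s]. *)
  set (r := ((s - l * L2) + (B - l * L1)) / 2).
  apply (window_excess_eq0_inv Theta l v L2 r); auto; [lra| |].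
  - apply N; unfold r; lra.
  - unfold r; lra.
Qed.

Lemma threshold_bound (c Theta l : R) (v : R -> R) (L1 L2 A1 A2 r0 : R) :
  0 < c -> 0 < l -> 0 < L1 -> L1 < L2 -> C2 v ->
  profile_equation c Theta l v L1 A1 ->
  profile_equation c Theta l v L2 A2 ->
  (forall r, r <= r0 -> v r <= Theta) ->
  forall s, v s <= Theta.
Proof.
  intros Hc Hl HL1 HL12 Hv E1 E2 H0 s.
  set (d := l * (L2 - L1)).
  assert (Hd : 0 < d) by (apply Rmult_lt_0_compat; lra).
  assert (Hn : forall n s, s < r0 + INR n * d -> v s <= Theta).
  { intros n; induction n as [|n IH].
    - intros x Hx; simpl in Hx; apply H0; lra.
    - intros x Hx.
      apply (threshold_bound_step c Theta l v L1 L2 A1 A2 (r0 + INR n * d));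
        auto.
      fold d; rewrite S_INR in Hx; lra. }
  destruct (INR_unbounded ((s - r0) / d)) as [n Hlt].
  apply (Hn n).
  apply Rmult_lt_compat_r with (r := d) in Hlt; [|exact Hd].
  replace ((s - r0) / d * d) with (s - r0) in Hlt by (field; lra); lra.
Qed.

(** * The scaling factor and the profile *)

(** The values that differ may be taken at the endpoints, where the evolution
    equation says nothing.  If [g] were constant on the open interval, its
    derivative would vanish there and continuity would make [g] constant up to
    the endpoints. *)
Lemma exists_increase_inside (g : R -> R) (a b t1 t2 : R) :
  (forall t, continuity_pt g t) ->
  a <= t1 <= b -> a <= t2 <= b -> g t1 <> g t2 ->
  exists s1 s2, a < s1 < b /\ a < s2 < b /\ g s1 < g s2.
Proof.
  intros Hc H1 H2 Hne; apply NNPP; intros Hno.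
  assert (Hcst : forall s1 s2, a < s1 < b -> a < s2 < b -> g s1 = g s2).
  { intros s1 s2 Hs1 Hs2.
    destruct (Rtotal_order (g s1) (g s2)) as [H|[H|H]]; [|exact H|];
      exfalso; apply Hno; [exists s1, s2 | exists s2, s1]; auto. }
  assert (Hd : forall x, a < x < b -> is_derive g x 0).
  { intros x Hx; apply (is_derive_ext_loc (fun _ => g x));
      [|apply @is_derive_const].
    apply (locally_interval _ x (Finite a) (Finite b)); simpl; try lra.
    intros y Hy1 Hy2; simpl in *; apply Hcst; lra. }
  apply Hne.
  rewrite (continuous_derive0_const g a b) with (x := t1) by auto.
  rewrite (continuous_derive0_const g a b) with (x := t2) by auto.
  reflexivity.
Qed.

(** The function [1 / g^2 + 2 k t] has zero derivative.  Hence
    [1 - 2 k g(0)^2 t] equals [(g(0) / g(t))^2], which gives its positivity and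
    the formula for [g] at once. *)
Lemma scaling_of_cubic_ode (g : R -> R) (k T : R) :
  (forall t, continuity_pt g t) ->
  (forall t, 0 <= t <= T -> 0 < g t) ->
  (forall t, 0 < t < T -> is_derive g t (k * g t ^ 3)) ->
  forall t, 0 <= t <= T ->
    0 < 1 - 2 * k * g 0 ^ 2 * t /\
    g t = g 0 / sqrt (1 - 2 * k * g 0 ^ 2 * t).
Proof.
  intros Hc Hp Hd t Ht.
  assert (HI : / g t ^ 2 + 2 * k * t = / g 0 ^ 2 + 2 * k * 0).
  { apply (continuous_derive0_const (fun t => / g t ^ 2 + 2 * k * t) 0 T);
      [| |exact Ht].
    - intros x Hx; specialize (Hp x Hx).
      apply continuity_pt_plus; [|reg].
      apply (continuity_pt_inv (fun x => g x ^ 2)).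
      + apply (continuity_pt_comp g (fun z => z ^ 2)); [apply Hc|reg].
      + apply pow_nonzero; lra.
    - intros x Hx; specialize (Hd x Hx); specialize (Hp x ltac:(lra)).
      assert (He : ex_derive g x) by (eexists; exact Hd).
      auto_derive.
      + repeat split; [exact He|]; rewrite Rmult_1_r.
        apply Rmult_integral_contrapositive; lra.
      + rewrite (is_derive_unique (fun x : R => g x) x _ Hd); field; lra. }
  pose proof (Hp t Ht) as Hgt; pose proof (Hp 0 ltac:(lra)) as Hg0.
  assert (HE : 1 - 2 * k * g 0 ^ 2 * t = (g 0 / g t) ^ 2).
  { replace ((g 0 / g t) ^ 2) with (g 0 ^ 2 * / g t ^ 2) by (field; lra).
    replace (/ g t ^ 2) with (/ g 0 ^ 2 - 2 * k * t) by lra.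
    field; lra. }
  assert (Hq : 0 < g 0 / g t) by (apply Rdiv_lt_0_compat; lra).
  rewrite HE; split; [apply pow_lt; exact Hq|].
  rewrite sqrt_pow2 by lra; field; lra.
Qed.

Lemma profile_of_gaussian_ode (v : R -> R) (k : R) :
  C2 v ->
  (forall r, is_derive (Derive v) r (k * r * Derive v r)) ->
  forall r, v r = heat_profile (v 0) (Derive v 0) (- k) r.
Proof.
  intros Hv Hode r; unfold heat_profile.
  assert (HD : forall x,
    is_derive v x (Derive v 0 * exp (- (- k * x ^ 2 / 2)))).
  { intros x.
    replace (Derive v 0 * exp (- (- k * x ^ 2 / 2))) with (Derive v x).
    { apply Derive_correct, (proj1 Hv 1%nat x); lia. }
    pose proof (gaussian_ode_invariant (Derive v) k (Rmax x 0 + 1)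
                  (fun r _ => Hode r) x 0) as H.
    pose proof (Rmax_l x 0); pose proof (Rmax_r x 0).
    specialize (H ltac:(lra) ltac:(lra)).
    replace (- (k * 0 ^ 2 / 2)) with 0 in H by field.
    rewrite exp_0, Rmult_1_r in H; rewrite <- H, Rmult_assoc, <- exp_plus.
    replace (- (k * x ^ 2 / 2) + - (- k * x ^ 2 / 2)) with 0 by field.
    rewrite exp_0; ring. }
  assert (Hc : forall x, continuous (fun x => exp (- (- k * x ^ 2 / 2))) x).
  { intros x.
    apply (ex_derive_continuous (fun x => exp (- (- k * x ^ 2 / 2)))).
    auto_derive; auto. }
  assert (HI := is_RInt_derive v (fun x => Derive v 0 * exp (- (- k * x ^ 2 / 2)))
            0 r (fun x _ => HD x)
            (fun x _ => continuous_scal_r (Derive v 0) _ x (Hc x))).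
  apply is_RInt_unique in HI.
  rewrite (RInt_scal (fun x => exp (- (- k * x ^ 2 / 2)))) in HI.
  - unfold scal, minus, plus, opp in HI; simpl in HI; unfold mult in HI.
    simpl in HI; simpl; lra.
  - apply (ex_RInt_continuous (fun x => exp (- (- k * x ^ 2 / 2)))).
    intros; apply Hc.
Qed.

Theorem theorem2p14
    (c Theta : R) (hc : 0 < c)
    (l : R) (hl : 0 < l)
    (r0 : R) (v : R -> R) (hv : C2 v)
    (hvr0 : forall r : R, r <= r0 -> v r <= Theta)
    (T : R) (hT : 0 < T)
    (lambda : R -> R) (hlambda : C1_on lambda 0 T)
    (hlambda_pos : forall t : R, 0 <= t <= T -> 0 < lambda t)
    (hlambda_alt :
       (forall t : R, 0 <= t <= T -> lambda t = 0) \/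
       (exists t1 t2 : R,
          0 <= t1 <= T /\ 0 <= t2 <= T /\ lambda t1 <> lambda t2))
    (u : R -> R -> R)
    (hu : solves_nonlocal c Theta l T u)
    (hform : forall x t : R, 0 <= t <= T -> u x t = v (lambda t * x)) :
  (forall x t : R, 0 <= t <= T -> u x t <= Theta) /\
  solves_heat c T u /\
  (exists lambda0 v0 v1 a : R,
     (forall t : R, 0 <= t <= T -> 0 < 1 + 2 * a * c * lambda0 ^ 2 * t) /\
     (forall x t : R, 0 <= t <= T ->
        u x t = heat_profile v0 v1 a (heat_scaling c lambda0 a t * x))).
Proof.
  destruct hlambda_alt as [h0 | (t1 & t2 & Ht1 & Ht2 & Hne)].
  (* A vanishing scaling contradicts positivity. *)
  { specialize (h0 0 ltac:(lra)); specialize (hlambda_pos 0 ltac:(lra)); lra. }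
  destruct (C1_on_extension lambda 0 T hT hlambda) as (g & dg & Hg & Hgc & Hgd).
  assert (Hgpos : forall t, 0 <= t <= T -> 0 < g t)
    by (intros t Ht; rewrite Hg; auto).
  assert (hform' : forall x t, 0 <= t <= T -> u x t = v (g t * x))
    by (intros x t Ht; rewrite Hg by exact Ht; auto).
  assert (Heq : forall t, 0 < t < T ->
            profile_equation c Theta l v (g t) (dg t / g t ^ 3)).
  { intros t Ht; apply (profile_equation_of_solution c Theta l T v g dg u t);
      auto; apply Hgpos; lra. }
  rewrite <- (Hg t1 Ht1), <- (Hg t2 Ht2) in Hne.
  destruct (exists_increase_inside g 0 T t1 t2 Hgc Ht1 Ht2 Hne)
    as (s1 & s2 & Hs1 & Hs2 & Hlt).
  assert (Hbound : forall s, v s <= Theta).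
  { apply (threshold_bound c Theta l v (g s1) (g s2)
             (dg s1 / g s1 ^ 3) (dg s2 / g s2 ^ 3) r0); auto.
    apply Hgpos; lra. }
  assert (Hu : forall x t, 0 <= t <= T -> u x t <= Theta)
    by (intros x t Ht; rewrite hform; auto).
  split; [exact Hu|]; split.
  - intros x t Ht; destruct (hu x t Ht) as [H1 [_ H2]]; split; [exact H1|].
    rewrite H2, (RInt_ext _ (fun _ => 0)).
    + rewrite RInt_const; unfold scal; simpl; unfold mult; simpl; ring.
    + intros y _; apply Rmax_right.
      enough (u y t <= Theta) by lra; apply Hu; lra.
  - assert (Hode : forall t, 0 < t < T -> forall r,
        is_derive (Derive v) r (dg t / g t ^ 3 / c * r * Derive v r)).
    { intros t Ht r.
      apply (profile_gaussian_ode c Theta l v (g t) (dg t / g t ^ 3) (r + 1));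
        auto; [apply Hgpos; lra | lra]. }
    destruct (classic (exists r, Derive v r <> 0)) as [[r1 Hr1]|Hz].
    (* If [v'] is not identically zero it vanishes nowhere, and the equation
       at [r = 1] shows that [dg t / g t ^ 3] does not depend on [t]. *)
    + assert (Hv1 : Derive v 1 <> 0).
      { intros H; apply Hr1.
        apply (gaussian_ode_zero (Derive v) (dg s1 / g s1 ^ 3 / c)
                 (Rmax r1 1 + 1) 1); auto;
          pose proof (Rmax_l r1 1); pose proof (Rmax_r r1 1); lra. }
      set (k := dg s1 / g s1 ^ 3).
      assert (Hk : forall t, 0 < t < T -> dg t = k * g t ^ 3).
      { intros t Ht; pose proof (Hgpos t ltac:(lra)).
        pose proof (is_derive_unique _ _ _ (Hode s1 Hs1 1)) as E1.
        pose proof (is_derive_unique _ _ _ (Hode t Ht 1)) as E2.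
        rewrite E1 in E2; apply Rmult_eq_reg_r in E2; [|exact Hv1].
        fold k in E2.
        replace k with (k / c * 1 * c) by (field; lra).
        rewrite E2; field; lra. }
      exists (g 0), (v 0), (Derive v 0), (- (k / c)).
      assert (HS : forall t, 0 <= t <= T ->
                0 < 1 - 2 * k * g 0 ^ 2 * t /\
                g t = g 0 / sqrt (1 - 2 * k * g 0 ^ 2 * t)).
      { apply scaling_of_cubic_ode; auto.
        intros t Ht; rewrite <- Hk by exact Ht; auto. }
      assert (Hsgn : forall t, 1 + 2 * - (k / c) * c * g 0 ^ 2 * t
                               = 1 - 2 * k * g 0 ^ 2 * t)
        by (intros t; field; lra).
      split.
      * intros t Ht; rewrite Hsgn; now apply HS.
      * intros x t Ht; unfold heat_scaling; rewrite Hsgn.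
        rewrite <- (proj2 (HS t Ht)), hform' by exact Ht.
        apply profile_of_gaussian_ode; auto.
        intros r; exact (Hode s1 Hs1 r).
    (* For a constant profile, the scaling [lambda0 = 0] represents [u] and
       makes the positivity condition trivial, whatever [lambda] is. *)
    + assert (Hz' : forall r, Derive v r = 0).
      { intros r; apply NNPP; intros H; apply Hz; now exists r. }
      exists 0, (v 0), 0, 0; split; [intros; lra|].
      intros x t Ht; rewrite hform' by exact Ht.
      rewrite (profile_of_gaussian_ode v (dg s1 / g s1 ^ 3 / c) hv (Hode s1 Hs1)).
      unfold heat_profile; rewrite Hz'; ring.
Qed.
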